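(* Let $OPT(n,w)$ denote the optimal symmetric social cost of the game $G(n;w)$. Then: 1. For every $w>2$ and every $\varepsilon>0$ there exists $n_0$ (depending on $w,\varepsilon$) such that for every $n>n_0$, $$\frac{n(n-1)}{2}\le OPT(n,w)\le (1+\varepsilon)\frac{n(n-1)}{2}.$$ 2. For every integer $n\ge 2$ and every $\varepsilon>0$ there exists $w_1$ (depending on $n,\varepsilon$) such that for every $w>w_1$, $$(1-\varepsilon)\sqrt{2w}\cdot\frac23 (n-1)\sqrt{n-1}\le OPT(n,w)\le (1+\varepsilon)\sqrt{2w}\cdot\left(\frac23 n\sqrt n+\sqrt n\right).$$
   Context: The game $G(n;w)$ ($n\ge 2$ an integer, $w>1$ real): there are $n$ agents and discrete time steps $t=1,2,3,\dots$. Initially all agents are outside an empty first-come-first-served queue. At each time step: (1) each agent still outside decides, simultaneously with the others and possibly using independent randomization, whether to enter the queue; (2) all agents who decided to enter are appended to the end of the queue in uniformly random order; (3) if the queue is nonempty, the first agent in it is processed and leaves, and each remaining agent in the queue incurs cost $w$; (4) each agent outside the queue incurs cost $1$. The state at the start of a step is $(m,k)$, where $m\ge1$ agents are still outside and $k\ge 0$ agents are in the queue, $m+k\le n$. An anonymous stationary strategy specifies, for each state $(m,k)$, a probability $q_{m,k}\in[0,1]$ of entering, used whenever that state occurs. A profile is symmetric if all agents use the same strategy. $c_{n,w}(S)\in[0,\infty]$ is the expected total cost of each agent under the symmetric profile $S$, and $C_{n,w}(S)=n\cdot c_{n,w}(S)$ is the social cost. The optimal symmetric social cost is $OPT(n,w)=\inf_S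 C_{n,w}(S)$, the infimum over all symmetric profiles $S$ of anonymous stationary strategies (not necessarily equilibria). *)

(* Defs.v *)
From HB Require Import structures.
From mathcomp Require Import all_boot all_order all_fingroup all_algebra.
From mathcomp Require Import all_classical all_reals all_analysis.

Set Implicit Arguments.
Unset Strict Implicit.
Unset Printing Implicit Defensive.

Import Order.TTheory GRing.Theory Num.Theory.
Local Open Scope ring_scope.

Section Game.
Variables (R : realType) (n : nat) (w : R).

(* The agents still outside, and the queue (head first).  An agent occurring in
   neither component has been processed. *)
Definition config : Type := ({set 'I_n} * seq 'I_n)%type.

Definition start : config := ([set: 'I_n], [::]).

(* A time step is determined by the list s of the agents entering during it, in
   the order in which they are appended to the queue. *)
Definition next (x : config) (s : seq 'I_n) : config :=
  (x.1 :\: [set i in s], behead (x.2 ++ s)).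

Definition step_cost (i : 'I_n) (x : config) (s : seq 'I_n) : R :=
  if i \in (next x s).1 then 1 else if i \in (next x s).2 then w else 0.

(* [q m k] is the probability of entering in state (m, k). *)
Definition strategy (q : nat -> nat -> R) : Prop :=
  forall m k : nat, (1 <= m)%N -> (m + k <= n)%N -> 0 <= q m k <= 1.

Variable q : nat -> nat -> R.

(* The agents outside decide independently, and each of the (size s)`! orders of
   the entering agents is equally likely. *)
Definition step_prob (x : config) (s : seq 'I_n) : R :=
  if uniq s && ([set i in s] \subset x.1) then
    let p := q #|x.1| (size x.2) in
    (\prod_(i in x.1) (if i \in s then p else 1 - p)) / ((size s)`!)%:R
  else 0.

Fixpoint history_prob (x : config) (h : seq (n.-bseq 'I_n)) : R :=
  if h is s :: h' then step_prob x s * history_prob (next x s) h' else 1.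

Fixpoint history_cost (i : 'I_n) (x : config) (h : seq (n.-bseq 'I_n)) : R :=
  if h is s :: h' then step_cost i x s + history_cost i (next x s) h' else 0.

(* Expectation of the cost of agent i over the first T steps. *)
Definition expected_cost (i : 'I_n) (T : nat) : R :=
  \sum_(h : T.-tuple (n.-bseq 'I_n))
    history_prob start h * history_cost i start h.

(* Costs are nonnegative, so that [expected_cost i T] is nondecreasing in T and,
   by monotone convergence, its supremum is the expected total cost. *)
Definition agent_cost (i : 'I_n) : \bar R :=
  ereal_sup (range (fun T : nat => (expected_cost i T)%:E)).

(* See [social_costE] below: this is n times the cost of any agent. *)
Definition social_cost : \bar R := (\sum_(i < n) agent_cost i)%E.

End Game.

Definition OPT (R : realType) (n : nat) (w : R) : \bar R :=
  ereal_inf [set social_cost n w q | q in [set q | strategy n q]].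

Section Symmetry.
Variables (R : realType) (n : nat) (w : R) (q : nat -> nat -> R).
Variable g : {perm 'I_n}.

Let act (x : config n) : config n := ([set g i | i in x.1], [seq g i | i <- x.2]).
Let acts (s : n.-bseq 'I_n) : n.-bseq 'I_n := [bseq of [seq g i | i <- s]].

Let next_act x (s : n.-bseq 'I_n) : next (act x) (acts s) = act (next x s).
Proof.
rewrite /next /act /=; congr pair; last by rewrite -map_cat behead_map.
apply/setP => j; rewrite -[j](permKV g) !inE !(mem_imset _ _ (@perm_inj _ g)).
by rewrite !inE (mem_map (@perm_inj _ g)).
Qed.

Let step_cost_act i x (s : n.-bseq 'I_n) :
  step_cost w (g i) (act x) (acts s) = step_cost w i x s.
Proof.
rewrite /step_cost next_act /act /= (mem_imset _ _ (@perm_inj _ g)).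
by rewrite (mem_map (@perm_inj _ g)).
Qed.

Let step_prob_act x (s : n.-bseq 'I_n) :
  step_prob q (act x) (acts s) = step_prob q x s.
Proof.
rewrite /step_prob /act /= (map_inj_uniq (@perm_inj _ g)) !size_map.
rewrite (card_imset _ (@perm_inj _ g)).
have -> : [set i in acts s] = [set g i | i in [set i in s]].
  apply/setP => j; rewrite -[j](permKV g) (mem_imset _ _ (@perm_inj _ g)) !inE.
  by rewrite (mem_map (@perm_inj _ g)).
have -> : ([set g i | i in [set i in s]] \subset [set g i | i in x.1])
    = ([set i in s] \subset x.1).
  apply/idP/idP => [/fintype.subsetP sub | ]; last exact: imsetS.
  apply/fintype.subsetP => i si; rewrite -(mem_imset _ _ (@perm_inj _ g)).
  by apply: sub; rewrite (mem_imset _ _ (@perm_inj _ g)).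
case: ifP => // _; congr (_ / _).
rewrite big_imset; last by move=> ? ? _ _; exact: perm_inj.
by apply: eq_bigr => i _; rewrite (mem_map (@perm_inj _ g)).
Qed.

Let history_prob_act x h :
  history_prob q (act x) (map acts h) = history_prob q x h.
Proof.
by elim: h x => //= s h IH x; rewrite step_prob_act next_act IH.
Qed.

Let history_cost_act i x h :
  history_cost w (g i) (act x) (map acts h) = history_cost w i x h.
Proof.
by elim: h x => //= s h IH x; rewrite step_cost_act next_act IH.
Qed.

Lemma expected_cost_perm i T : expected_cost w q (g i) T = expected_cost w q i T.
Proof.
have acts_inj : injective acts.
  by move=> s t /(congr1 val) /(inj_map (@perm_inj _ g)) /val_inj.
have actt_inj : injective (fun h : T.-tuple (n.-bseq 'I_n) => [tuple of map acts h]).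
  by move=> h h' /(congr1 val) /(inj_map acts_inj) /val_inj.
have act0 : act (start n) = start n.
  by congr pair; apply/setP => j; rewrite -[j](permKV g) (mem_imset _ _ (@perm_inj _ g)) !inE.
rewrite /expected_cost (reindex_inj actt_inj); apply: eq_bigr => h _ /=.
by rewrite -{1 2}act0 history_prob_act history_cost_act.
Qed.

End Symmetry.

Lemma social_costE (R : realType) (n : nat) (w : R) (q : nat -> nat -> R) (i : 'I_n) :
  social_cost n w q = (n%:R%:E * agent_cost w q i)%E.
Proof.
have E (j : 'I_n) : agent_cost w q j = agent_cost w q i.
  have eqC : expected_cost w q j = expected_cost w q i.
    by apply: funext => T; rewrite -(expected_cost_perm _ _ (tperm i j) i) tpermL.
  by rewrite /agent_cost eqC.
by rewrite /social_cost (eq_bigr _ (fun j _ => E j)) sumr_const card_ord mule_natl.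
Qed.

(* Main.v *)
Require Import Defs.
From HB Require Import structures.
From mathcomp Require Import all_boot all_order all_algebra.
From mathcomp Require Import all_classical all_reals all_analysis.
From mathcomp Require Import ring lra zify.

(* By symmetry the social cost is governed by the numbers [(m, k)] of agents outside
   and in the queue, of which only the former moves at random, by a binomial
   law.  Functions of [(m, k)] that decrease in mean by at least (at most) the
   expected cost of each step bound the social cost from above (below).

   Lower bounds.  Each of the agents not yet processed costs at least 1 per step,
   and at most one of them is processed, which gives [n (n - 1) / 2].  For large
   [w], going from [m] to [m - 1] agents outside costs about [1 / p] for waiting
   and [w (m - 1) p / 2] for collisions, hence at least [sqrt (2 w (m - 1))].

   Upper bounds.  Agents enter only an empty queue.  Entering with probability
   [A / m] keeps the queue busy most of the time, at the cost of a queue of bounded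
   length; entering with probability [sqrt (2 / (m w))] optimizes the trade-off
   between waiting and collisions. *)

Set Implicit Arguments.
Unset Strict Implicit.
Unset Printing Implicit Defensive.

Import Order.TTheory GRing.Theory Num.Theory.
Local Open Scope ring_scope.

(** * Expectations under a binomial law and their factorial moments *)

Section BinomialExpectation.
Variables (R : realFieldType) (p : R).

Definition bin_exp (m : nat) (f : nat -> R) : R :=
  \sum_(j < m.+1) 'C(m, j)%:R * p ^+ j * (1 - p) ^+ (m - j) * f j.

Lemma eq_bin_exp m f g : (forall j, (j <= m)%N -> f j = g j) ->
  bin_exp m f = bin_exp m g.
Proof. by move=> fg; apply: eq_bigr => j _; rewrite fg // -ltnS. Qed.

Lemma bin_expD m f g : bin_exp m (fun j => f j + g j) = bin_exp m f + bin_exp m g.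
Proof. by rewrite -big_split; apply: eq_bigr => j _; rewrite mulrDr. Qed.

Lemma bin_expZ m c f : bin_exp m (fun j => c * f j) = c * bin_exp m f.
Proof. by rewrite mulr_sumr; apply: eq_bigr => j _; rewrite mulrCA. Qed.

Lemma bin_expB m f g : bin_exp m (fun j => f j - g j) = bin_exp m f - bin_exp m g.
Proof. by rewrite -sumrB; apply: eq_bigr => j _; rewrite mulrBr. Qed.

Lemma bin_exp_size0 f : bin_exp 0 f = f 0%N.
Proof. by rewrite /bin_exp big_ord1 bin0 !expr0 !mul1r. Qed.

(** The guard on [p] matches [strategy], which constrains [q m k] only for positive [m]. *)
Lemma le_bin_exp m f g : ((0 < m)%N -> 0 <= p <= 1) ->
  (forall j, (j <= m)%N -> f j <= g j) -> bin_exp m f <= bin_exp m g.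
Proof.
case: m => [_ fg|m /(_ isT) /andP[p0 p1] fg]; first by rewrite !bin_exp_size0 fg.
apply: ler_sum => j _; apply: ler_wpM2l.
  by rewrite mulr_ge0 ?mulr_ge0 ?exprn_ge0 ?subr_ge0.
by apply: fg; rewrite -ltnS.
Qed.

(** The absorption identity [(j + 1) C(m + 1, j + 1) = (m + 1) C(m, j)] extracts one factor of the
    falling factorial, so induction on [r] ends at total mass 1. *)
Lemma bin_exp_ffact m r :
  bin_exp m (fun j => (j ^_ r)%:R) = (m ^_ r)%:R * p ^+ r.
Proof.
have base k : bin_exp k (fun=> 1) = 1.
  rewrite -[RHS](expr1n _ k) -[in RHS](subrK p 1) exprDn.
  apply: eq_bigr => j _; rewrite mulr1 -mulr_natl; ring.
elim: r m => [|r IH] m; first by rewrite expr0 mulr1; exact: base.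
case: m => [|m].
  by rewrite /bin_exp big_ord_recl big_ord0 !ffact0n /= mulr0 mul0r addr0.
rewrite /bin_exp big_ord_recl /= ffact0n mulr0 add0r ffactSS natrM exprS.
rewrite mulrACA -IH mulr_sumr; apply: eq_bigr => j _.
rewrite /bump /= add1n subSS ffactSS natrM exprS.
have := mul_bin_diag m.+1 j => /=/(congr1 (fun k => k%:R : R)); rewrite !natrM => E.
transitivity (j.+1%:R * 'C(m.+1, j.+1)%:R * (p * p ^+ j * (1 - p) ^+ (m - j)
  * (j ^_ r)%:R)); first by ring.
by rewrite -E; ring.
Qed.

Lemma bin_exp_cst m c : bin_exp m (fun=> c) = c.
Proof.
transitivity (c * bin_exp m (fun j => (j ^_ 0)%:R)).
  by rewrite -bin_expZ; apply: eq_bin_exp => j _; rewrite mulr1.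
by rewrite bin_exp_ffact mul1r mulr1.
Qed.

Lemma bin_exp0 m : bin_exp m (fun j => (j == 0)%:R) = (1 - p) ^+ m.
Proof.
rewrite /bin_exp big_ord_recl /= big1 => [|j _]; last by rewrite mulr0.
by rewrite bin0 expr0 subn0; ring.
Qed.

Lemma bin_exp_id m : bin_exp m (fun j => j%:R) = m%:R * p.
Proof.
have := bin_exp_ffact m 1; rewrite expr1 [in RHS]ffactn1 => <-.
by apply: eq_bin_exp => j _; rewrite ffactn1.
Qed.

Lemma natr_ffact2 j : (j ^_ 2)%:R = j%:R * (j%:R - 1) :> R.
Proof. by case: j => [|j]; rewrite ?mul0r// ffactnS ffactn1 natrM -natr1 addrK. Qed.

Lemma natr_ffact3 j : (j ^_ 3)%:R = j%:R * (j%:R - 1) * (j%:R - 2) :> R.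
Proof.
case: j => [|j]; first by rewrite !mul0r.
by rewrite ffactSS natrM natr_ffact2 -!natr1; ring.
Qed.

Lemma bin_exp_ffact2 m :
  bin_exp m (fun j => j%:R * (j%:R - 1)) = m%:R * (m%:R - 1) * p ^+ 2.
Proof.
rewrite -natr_ffact2 -bin_exp_ffact.
by apply: eq_bin_exp => j _; rewrite natr_ffact2.
Qed.

Lemma bin_exp_ffact3 m :
  bin_exp m (fun j => j%:R * (j%:R - 1) * (j%:R - 2))
  = m%:R * (m%:R - 1) * (m%:R - 2) * p ^+ 3.
Proof.
rewrite -natr_ffact3 -bin_exp_ffact.
by apply: eq_bin_exp => j _; rewrite natr_ffact3.
Qed.

End BinomialExpectation.

Lemma bin_exp_never (R : realFieldType) m (f : nat -> R) : bin_exp 0 m f = f 0%N.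
Proof.
rewrite /bin_exp big_ord_recl big1 => [|j _]; last by rewrite /= expr0n !(mulr0, mul0r).
by rewrite /= bin0 expr0 subr0 expr1n !mul1r addr0.
Qed.

(** * From agents and queues to the pairs [(m, k)] *)

Section Reduction.
Variables (R : realType) (n : nat) (w : R) (q : nat -> nat -> R).

Lemma step_probE (x : config n) (s : seq 'I_n) :
  uniq s -> {subset s <= x.1} ->
  let p := q #|x.1| (size x.2) in
  step_prob q x s = p ^+ size s * (1 - p) ^+ (#|x.1| - size s) / (size s)`!%:R.
Proof.
move=> us sx /=; rewrite /step_prob us /=; case: ifPn; last first.
  by case/negP; apply/fintype.subsetP => i; rewrite inE; exact: sx.
move=> _; congr (_ / _); rewrite (bigID (mem s)) /=.
have cs : #|[pred i | i \in x.1 & i \in s]| = size s.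
  rewrite -(card_uniqP us); apply: eq_card => i; rewrite !inE.
  by apply: andb_idl; exact: sx.
congr (_ * _).
  under eq_bigr => i /andP[_ ->] do [].
  by rewrite prodr_const; congr (_ ^+ _).
under eq_bigr => i /andP[_ /negbTE ->] do [].
rewrite prodr_const; congr (_ ^+ _).
rewrite -cs -(cardID (mem s) (mem x.1)).
rewrite [X in (X + _ - _)%N](_ : _ = #|[pred i | i \in x.1 & i \in s]|); last first.
  by apply: eq_card => i; rewrite !inE.
by rewrite addKn; apply: eq_card => i; rewrite !inE /= andbC.
Qed.

Lemma step_prob_out (x : config n) (s : seq 'I_n) :
  ~~ (uniq s && all (mem x.1) s) -> step_prob q x s = 0.
Proof.
rewrite /step_prob => us; case: ifPn => // /andP[u /fintype.subsetP sx].
case/negP: us; rewrite u; apply/allP => i si; apply: sx.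
by rewrite inE.
Qed.

(** Group the lists by length [k]: the [m ^_ k] duplicate-free lists of outside agents are equally
    likely, and dividing by [k] factorial for the order leaves ['C(m, k)]. *)
Lemma sum_step_prob (x : config n) (f : nat -> R) :
  \sum_(s : n.-bseq 'I_n) step_prob q x s * f (size s)
  = bin_exp (q #|x.1| (size x.2)) #|x.1| f.
Proof.
set p := q _ _; set m := #|x.1|.
have mn : (m <= n)%N by rewrite -[n in (_ <= n)%N]card_ord max_card.
rewrite (reindex (@tagged_tuple_bseq n 'I_n)) /=; last exact/onW_bij.
rewrite -(@sig_big_dep _ _ _ _ (fun k : 'I_n.+1 => k.-tuple 'I_n) predT
  (fun _ _ => true) (fun k t => step_prob q x t * f (size t))) /=.
pose c k : R := 'C(m, k)%:R * p ^+ k * (1 - p) ^+ (m - k) * f k.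
rewrite /bin_exp (big_ord_widen n.+1 c) // [RHS]big_mkcond /=.
apply: eq_bigr => k _.
rewrite (bigID (fun t : k.-tuple _ => uniq t && all (mem x.1) t)) /=.
rewrite [X in _ + X]big1 ?addr0; last first.
  by move=> t /step_prob_out ->; rewrite mul0r.
rewrite (eq_bigr (fun=> p ^+ k * (1 - p) ^+ (m - k) / k`!%:R * f k)); last first.
  move=> t /andP[u /allP a]; rewrite step_probE// size_tuple//.
rewrite sumr_const.
rewrite (_ : #|_| = m ^_ k)%N; last first.
  by rewrite -card_uniq_tuples; apply: eq_card => t; rewrite !inE andbC.
rewrite -bin_ffact -[LHS]mulr_natr natrM.
have k0 : k`!%:R != 0 :> R by rewrite pnatr_eq0 -lt0n fact_gt0.
case: ifPn => [_|]; first by rewrite /c; field.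
by rewrite -leqNgt => mk; rewrite bin_small// mul0r mulr0.
Qed.

(** Invariant under which the sizes of the two components count distinct agents. *)
Definition valid (x : config n) := uniq x.2 && [disjoint x.2 & x.1].

Lemma valid_start : valid (start n).
Proof. by rewrite /valid /= disjoint_has. Qed.

Lemma valid_next x (s : seq 'I_n) :
  valid x -> uniq s -> all (mem x.1) s ->
  [/\ valid (Defs.next x s), #|(Defs.next x s).1| = (#|x.1| - size s)%N
    & size (Defs.next x s).2 = (size x.2 + size s).-1].
Proof.
move=> /andP[ux dx] us /allP sx; split.
- have u : uniq (x.2 ++ s).
    rewrite cat_uniq ux us andbT; apply/hasPn => i /sx ix.
    by apply/negP => ix2; have := disjointFl dx ix; rewrite ix2.
  rewrite /valid /=; apply/andP; split.
    by move: u; case: (x.2 ++ s) => //= a l /andP[].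
  rewrite disjoint_subset; apply/fintype.subsetP => i /mem_behead.
  rewrite mem_cat !inE negb_and negbK; case: (i \in s); rewrite ?orbT//= orbF.
  by move=> /(disjointFr dx) ->.
- rewrite /= cardsDS; last by apply/fintype.subsetP => i; rewrite inE; exact: sx.
  by rewrite cardsE (card_uniqP us).
- by rewrite /= size_behead size_cat.
Qed.

Lemma sum_step_cost x (s : seq 'I_n) :
  valid x -> uniq s -> all (mem x.1) s ->
  \sum_i step_cost w i x s
  = (#|x.1| - size s)%:R + w * (size x.2 + size s).-1%:R.
Proof.
move=> vx us sx; have [/andP[uy dy] <- <-] := valid_next vx us sx.
rewrite /step_cost; set y := Defs.next x s in uy dy *.
rewrite (bigID (mem y.1)) /=; congr (_ + _).
  by under eq_bigr => i -> do []; rewrite sumr_const.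
rewrite (eq_bigr (fun i => if i \in y.2 then w else 0)); last first.
  by move=> i /negbTE ->.
rewrite -big_mkcondr sumr_const -[LHS]mulr_natr; congr (_ * _%:R).
rewrite -(card_uniqP uy); apply: eq_card => i; apply: andb_idl => iy.
by apply: negbT; exact: disjointFr dy iy.
Qed.

(* Expected social cost of the first [T] steps from state [(m, k)]. *)
Fixpoint cost_upto (T m k : nat) : R :=
  if T is T'.+1 then
    bin_exp (q m k) m (fun j => (m - j)%:R + w * (k + j).-1%:R
      + cost_upto T' (m - j) (k + j).-1)
  else 0.

Lemma sum_tupleS (A : finType) T (F : seq A -> R) :
  \sum_(h : T.+1.-tuple A) F h = \sum_(a : A) \sum_(h : T.-tuple A) F (a :: h).
Proof.
rewrite pair_big (reindex (fun u : A * T.-tuple A => [tuple of u.1 :: u.2])) //=.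
exists (fun h : T.+1.-tuple A => (thead h, [tuple of behead h])) => [[a h] _|h _] /=.
  by congr pair; apply: val_inj.
by rewrite [RHS]tuple_eta; apply: val_inj.
Qed.

(** The constant [c] carries the cost of the steps already taken. Absorbing each step cost into it
    spares a separate proof that history probabilities sum to 1. *)
Lemma sum_history_cost T x c : valid x ->
  \sum_(h : T.-tuple (n.-bseq 'I_n))
    history_prob q x h * (c + \sum_i history_cost w i x h)
  = c + cost_upto T #|x.1| (size x.2).
Proof.
elim: T x c => [|T IH] x c vx.
  rewrite (big_pred1 [tuple]) => [|h]; last by apply/esym/eqP; exact: tuple0.
  by rewrite /= mul1r big1// !addr0.
rewrite (sum_tupleS _ (fun h =>
  history_prob q x h * (c + \sum_i history_cost w i x h))) /=.
rewrite -[X in X + _](bin_exp_cst (q #|x.1| (size x.2)) #|x.1|) -bin_expD.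
rewrite -sum_step_prob.
apply: eq_bigr => s _.
have [/andP[us sx]|/step_prob_out ->] := boolP (uniq s && all (mem x.1) s); last first.
  by rewrite mul0r big1 // => h _; rewrite !mul0r.
have [vy c1 c2] := valid_next vx us sx.
rewrite -c1 -[in cost_upto _ _ _]c2 addrA -IH // mulr_sumr; apply: eq_bigr => h _.
by rewrite big_split /= sum_step_cost// -c1 mulrA addrA.
Qed.

Lemma sum_expected_cost T :
  \sum_(i < n) expected_cost w q i T = cost_upto T n 0.
Proof.
have := sum_history_cost T 0 valid_start; rewrite add0r /= cardsT card_ord => <-.
rewrite exchange_big; apply: eq_bigr => h _.
by rewrite add0r mulr_sumr.
Qed.

Lemma expected_costE (i : 'I_n) T : expected_cost w q i T = cost_upto T n 0 / n%:R.
Proof.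
have n0 : n%:R != 0 :> R by rewrite pnatr_eq0 -lt0n (leq_trans _ (ltn_ord i)).
rewrite -sum_expected_cost (eq_bigr (fun=> expected_cost w q i T)).
  by rewrite sumr_const card_ord -[X in _ = X / _]mulr_natr mulfK.
by move=> j _; rewrite -(expected_cost_perm _ _ (perm.tperm i j) i) perm.tpermL.
Qed.

Lemma social_cost_le (U : R) : (forall T, cost_upto T n 0 <= U) ->
  (0 < n)%N -> (social_cost n w q <= U%:E)%E.
Proof.
move=> TU n0; rewrite (social_costE _ _ (Ordinal n0)).
have nR : 0 < n%:R :> R by rewrite ltr0n.
rewrite -[U](divfK (lt0r_neq0 nR)) mulrC EFinM lee_pmul2l ?lte_fin //.
apply: ge_ereal_sup => _ [T _ <-]; rewrite lee_fin expected_costE.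
by rewrite ler_pM2r ?invr_gt0.
Qed.

Lemma social_cost_ge (T : nat) : (0 < n)%N ->
  ((cost_upto T n 0)%:E <= social_cost n w q)%E.
Proof.
move=> n0; rewrite (social_costE _ _ (Ordinal n0)).
have nR : 0 < n%:R :> R by rewrite ltr0n.
rewrite -[cost_upto T n 0](divfK (lt0r_neq0 nR)) mulrC EFinM lee_pmul2l ?lte_fin //.
by apply: ereal_sup_ubound; exists T => //; rewrite expected_costE.
Qed.

End Reduction.

(** * Potential functions for upper and lower bounds *)

Section Potential.
Variables (R : realType) (n : nat) (w : R) (q : nat -> nat -> R).
Hypothesis q_strategy : strategy n q.

Let step_mean (U : nat -> nat -> R) (m k : nat) : R :=
  bin_exp (q m k) m (fun j => (m - j)%:R + w * (k + j).-1%:R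
    + U (m - j)%N (k + j).-1).

Lemma cost_upto_le (U : nat -> nat -> R) :
  (forall m k, (m + k <= n)%N -> 0 <= U m k) ->
  (forall m k, (m + k <= n)%N -> step_mean U m k <= U m k) ->
  forall T m k, (m + k <= n)%N -> cost_upto w q T m k <= U m k.
Proof.
move=> U0 stepU; elim=> [|T IH] m k mkn; first exact: U0.
apply: le_trans (stepU _ _ mkn); apply: le_bin_exp => [m0|j jm].
  exact: q_strategy.
by rewrite lerD2l; apply: IH; lia.
Qed.

Lemma step_cost_ge m k j : 1 <= w -> (j <= m)%N ->
  (m + k).-1%:R <= (m - j)%:R + w * (k + j).-1%:R.
Proof.
move=> w1 jm; apply: (@le_trans _ _ ((m - j) + (k + j).-1)%:R).
  by rewrite ler_nat; lia.
by rewrite natrD lerD2l ler_peMl.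
Qed.

(** The horizon may end before the potential is used up, so [L] is scaled by a factor tending to 1.
    A fraction [a] of each step cost pays for the decrease of [L]; the rest, at least [1 - a] while
    two agents remain, pays for the growth of the factor. *)
Lemma cost_upto_ge (L : nat -> nat -> R) (M : R) : 1 <= w -> 0 < M ->
  (forall m k, (m + k <= n)%N -> L m k <= M) ->
  (forall m k, (m + k <= 1)%N -> L m k <= 0) ->
  (forall m k, (m + k <= n)%N -> L m k <= step_mean L m k) ->
  forall T m k, (m + k <= n)%N ->
    T%:R / (T%:R + M) * L m k <= cost_upto w q T m k.
Proof.
move=> w1 M0 LM L1 stepL; elim=> [|T IH] m k mkn; first by rewrite !mul0r.
set a := T%:R / (T%:R + M) in IH *.
have T0 : 0 <= T%:R :> R by [].
have a0 : 0 <= a by rewrite /a divr_ge0//; lra.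
have a1 : a = 1 - M / (T%:R + M) by rewrite /a; field; lra.
have q01 : (0 < m)%N -> 0 <= q m k <= 1 by move=> m0; exact: q_strategy.
have -> : T.+1%:R / (T.+1%:R + M) = a + M / ((T%:R + M) * (T%:R + 1 + M)).
  by rewrite /a -natr1; field; lra.
(* [b] is the increment of the factor from [T] to [T + 1]; it satisfies [b * M <= 1 - a]. *)
set b := M / ((T%:R + M) * (T%:R + 1 + M)).
have b0 : 0 <= b by rewrite /b divr_ge0 ?mulr_ge0//; lra.
apply: (@le_trans _ _ (a * step_mean L m k + (1 - a) * (m + k).-1%:R)); last first.
  rewrite -bin_expZ -[X in _ + X](bin_exp_cst (q m k) m) -bin_expD.
  apply: le_bin_exp => // j jm; rewrite -/(cost_upto w q T _ _).
  have := step_cost_ge k w1 jm => sc.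
  have := IH (m - j)%N (k + j).-1; rewrite (_ : (_ <= n)%N); last by lia.
  move=> /(_ isT) IHj.
  have : (1 - a) * (m + k).-1%:R <= (1 - a) * ((m - j)%:R + w * (k + j).-1%:R).
    by apply: ler_wpM2l => //; rewrite a1 opprB addrC subrK divr_ge0//; lra.
  lra.
rewrite mulrDl lerD ?ler_wpM2l ?stepL//.
case: (leqP (m + k) 1) => mk1.
  apply: (@le_trans _ _ 0); first by rewrite mulr_ge0_le0// L1.
  by rewrite mulr_ge0// a1 opprB addrC subrK divr_ge0//; lra.
apply: (@le_trans _ _ (b * M)); first by rewrite ler_wpM2l// LM.
apply: (@le_trans _ _ (1 - a)); last first.
  by rewrite ler_peMr ?a1 ?opprB ?ler1n//; [rewrite addrC subrK divr_ge0//; lra|lia].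
rewrite a1 opprB addrC subrK /b -subr_ge0.
have -> : M / (T%:R + M) - M / ((T%:R + M) * (T%:R + 1 + M)) * M
  = M * (T%:R + 1) / ((T%:R + M) * (T%:R + 1 + M)) by field; lra.
by rewrite divr_ge0 ?mulr_ge0//; lra.
Qed.

Lemma social_cost_ge_potential (L : nat -> nat -> R) (M : R) : (0 < n)%N ->
  1 <= w -> 0 < M ->
  (forall m k, (m + k <= n)%N -> L m k <= M) ->
  (forall m k, (m + k <= 1)%N -> L m k <= 0) ->
  (forall m k, (m + k <= n)%N -> L m k <= step_mean L m k) ->
  ((L n 0)%:E <= social_cost n w q)%E.
Proof.
move=> n0 w1 M0 LM L1 stepL.
have key T : ((T%:R / (T%:R + M) * L n 0)%:E <= social_cost n w q)%E.
  apply: le_trans (social_cost_ge w q T n0); rewrite lee_fin.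
  by apply: cost_upto_ge => //; rewrite addn0.
case: social_cost key => [r||] key; last 2 first.
- by rewrite leey.
- by have := key 0%N; rewrite leeNy_eq.
rewrite lee_fin leNgt; apply/negP => rL.
have d0 : 0 < L n 0 - r by rewrite subr_gt0.
(* This [T] makes [T * (L n 0 - r) > r * M], that is, the scaled bound exceeds [r]. *)
pose T := (Num.truncn (`|r| * M / (L n 0 - r))).+1.
have : `|r| * M / (L n 0 - r) < T%:R by exact: truncnS_gt.
rewrite ltr_pdivrMr// => big.
have T0 : 0 <= T%:R :> R by [].
have TM : 0 < T%:R + M by lra.
have := key T; rewrite lee_fin mulrAC ler_pdivrMr// => H.
have := ler_norm r => /(ler_wpM2r (ltW M0)); lra.
Qed.

End Potential.

Lemma OPT_ge (R : realType) (n : nat) (w : R) (L : nat -> nat -> R) (M : R) :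
  (0 < n)%N -> 1 <= w -> 0 < M ->
  (forall m k, (m + k <= n)%N -> L m k <= M) ->
  (forall m k, (m + k <= 1)%N -> L m k <= 0) ->
  (forall p m k, (m + k <= n)%N -> ((0 < m)%N -> 0 <= p <= 1) ->
    L m k <= bin_exp p m (fun j => (m - j)%:R + w * (k + j).-1%:R
      + L (m - j)%N (k + j).-1)) ->
  ((L n 0)%:E <= OPT n w)%E.
Proof.
move=> n0 w1 M0 LM L1 step; apply: le_ereal_inf_tmp => _ [q /= qs <-].
apply: (social_cost_ge_potential qs n0 w1 M0 LM L1) => m k mkn.
by apply: step => // m0; exact: qs.
Qed.

(** Agents enter only an empty queue, with probability [x m]. If [j] enter, then until the queue is
    empty again those outside pay [j (m - j)] and those queued pay [w j (j - 1) / 2]; if none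
    enters, the step costs [m]. The hypothesis compares the mean of this cost with the mean drop of
    [V]. *)
Lemma OPT_le (R : realType) (n : nat) (w : R) (V x : nat -> R) :
  (0 < n)%N -> 0 <= w -> (forall m, 0 <= V m) ->
  (forall m, (0 < m <= n)%N -> 0 <= x m <= 1) ->
  (forall m, (0 < m <= n)%N ->
    m%:R * (1 - x m) ^+ m + m%:R * (m%:R - 1) * x m * (1 - x m)
      + w / 2 * (m%:R * (m%:R - 1) * x m ^+ 2)
    <= bin_exp (x m) m (fun j => V m - V (m - j)%N)) ->
  (OPT n w <= (V n)%:E)%E.
Proof.
move=> n0 w0 V0 x01 Vx.
pose q (m k : nat) := if k == 0%N then x m else 0.
have qs : strategy n q.
  move=> m k m0 mkn; rewrite /q; case: eqP => _; last by rewrite lexx ler01.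
  by apply: x01; lia.
(* Beyond [V m], this is the exact cost of draining a queue of length [k], so [U] drops by exactly
   the step cost while the queue is nonempty. *)
pose U (m k : nat) := V m + k%:R * m%:R + w / 2 * (k%:R * (k%:R - 1)).
have kk (k : nat) : 0 <= k%:R * (k%:R - 1) :> R.
  by rewrite -natr_ffact2.
have Un : U n 0%N = V n by rewrite /U !mul0r mulr0 !addr0.
apply: (@le_trans _ _ (social_cost n w q)); first by apply: ereal_inf_lbound; exists q.
rewrite -Un; apply: social_cost_le => // T.
apply: (cost_upto_le qs) => [m k _|m k mkn|]; last by rewrite addn0.
  apply: addr_ge0; first by rewrite addr_ge0 ?mulr_ge0.
  by apply: mulr_ge0 => //; apply: divr_ge0.
case: k mkn => [|k] mkn; last first.
  rewrite /q /= bin_exp_never subn0 addn0 /= /U -natr1 le_eqVlt; apply/orP; left.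
  by apply/eqP; field.
case: m mkn => [|m] mkn.
  by rewrite bin_exp_size0 /= /U !mul0r !mulr0 !addr0 !add0r.
set mm := m.+1; rewrite /q /=.
have /Vx : (0 < mm <= n)%N by lia.
rewrite bin_expB bin_exp_cst => H.
rewrite [leRHS](_ : _ = V mm); last by rewrite /U !mul0r mulr0 !addr0.
rewrite (_ : bin_exp _ _ _ = bin_exp (x mm) mm (fun j => mm%:R * (j == 0%N)%:R
  + (mm%:R - 1) * j%:R + (w / 2 - 1) * (j%:R * (j%:R - 1)) + V (mm - j)%N)).
  rewrite !bin_expD !bin_expZ bin_exp0 bin_exp_id bin_exp_ffact2.
  lra.
apply: eq_bin_exp => j jm; rewrite /U natrB//.
by case: j jm => [|j] jm /=; rewrite -?natr1; field.
Qed.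

(** * Bounds for fixed [w] and large [n] *)

Lemma natr_bin2 (R : realFieldType) n : 'C(n, 2)%:R = n%:R * (n%:R - 1) / 2 :> R.
Proof. by rewrite -natr_ffact2 -bin_ffact natrM mulfK ?pnatr_eq0. Qed.

(** Processing one of [N] remaining agents lowers the potential ['C(N, 2)] by [N - 1], which the
    step costs at least. *)
Lemma OPT_ge_triangular (R : realType) (n : nat) (w : R) : (0 < n)%N -> 1 <= w ->
  ((n%:R * (n%:R - 1) / 2)%:E <= OPT n w)%E.
Proof.
move=> n0 w1; rewrite -natr_bin2 -{1}[n]addn0.
apply: (@OPT_ge _ _ _ (fun m k => 'C(m + k, 2)%:R) 'C(n, 2).+1%:R) => //.
- by move=> m k mkn; rewrite ler_nat ltnW// ltnS leq_bin2l.
- by move=> m k; case: (m + k)%N => [|[|]].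
move=> p m k mkn p01; rewrite -[leLHS](bin_exp_cst p m).
apply: le_bin_exp => // j jm; apply: le_trans (lerD (step_cost_ge k w1 jm) (lexx _)).
rewrite -natrD ler_nat.
have [mk0|mk0] := posnP (m + k); first by rewrite mk0.
have [kj0|kj0] := posnP (k + j).
  by rewrite kj0 addn0 (_ : m - j = m + k)%N ?leq_addl//; lia.
have -> : (m - j + (k + j).-1 = (m + k).-1)%N by lia.
by rewrite -{1}(prednK mk0) binS bin1 addnC.
Qed.

(** Bounds the probability that nobody enters; the induction rests on
    [(1 - x) (1 + (m + 1) x) <= 1 + m x]. *)
Lemma expr_onem_le (R : realFieldType) (x : R) m : 0 <= x <= 1 ->
  (1 - x) ^+ m * (1 + m%:R * x) <= 1.
Proof.
move=> /andP[x0 x1]; elim: m => [|m IH]; first by rewrite expr0 mul0r addr0 mulr1.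
apply: le_trans IH; rewrite exprSr -mulrA ler_wpM2l ?exprn_ge0 ?subr_ge0//.
have m0 : 0 <= m%:R * (x * x) by rewrite !mulr_ge0.
have xx : 0 <= x * x by rewrite mulr_ge0.
rewrite -natr1; nra.
Qed.

(* When the queue is empty, the expected number of entering agents is [A] if at
   least [A] agents are outside. *)
Lemma OPT_le_refill (R : realType) (n : nat) (w A : R) :
  (0 < n)%N -> 0 <= w -> 1 <= A ->
  (OPT n w <= (n%:R * (n%:R - 1) / 2
     + (n%:R / (A * A) + w * A / 2) * n%:R)%:E)%E.
Proof.
move=> n0 w0 A1; set c := _ / _ + _ / 2.
have A0 : 0 < A by lra.
have c0 : 0 <= c by rewrite /c addr_ge0// divr_ge0// mulr_ge0// ltW.
pose x m : R := Num.min 1 (A / m%:R).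
apply: (@OPT_le _ _ _ (fun m => m%:R * (m%:R - 1) / 2 + c * m%:R) x) => //
  [m|m /andP[m0 mn]|m /andP[m0 mn]].
- by rewrite -natr_bin2 addr_ge0// mulr_ge0.
- by rewrite /x le_min ler01 divr_ge0 ?(ltW A0)// ge_min lexx.
have mR : 0 < m%:R :> R by rewrite ltr0n.
have xE : 0 < x m /\ x m <= 1.
  by rewrite /x lt_min ltr01 divr_gt0// ge_min lexx.
have xA : m%:R * x m <= A.
  apply: (@le_trans _ _ (m%:R * (A / m%:R))); last by rewrite mulrC divfK ?gt_eqF.
  by rewrite ler_wpM2l ?(ltW mR)// /x ge_min lexx orbT.
rewrite (_ : bin_exp _ _ _ = bin_exp (x m) m (fun j => (m%:R - 1 + c) * j%:R
    - 2^-1 * (j%:R * (j%:R - 1)))); last first.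
  by apply: eq_bin_exp => j jm; rewrite natrB//; field.
rewrite bin_expB !bin_expZ bin_exp_id bin_exp_ffact2.
(* If [m <= A], everyone enters and no step is idle. Otherwise [m * x m = A], and nobody enters with
   probability at most [1 / (1 + A)]. *)
have idle : m%:R * (1 - x m) ^+ m <= n%:R / (A * A) * (m%:R * x m).
  case: (leP 1 (A / m%:R)) => Am.
    have -> : x m = 1 by rewrite /x; apply/min_idPl.
    by rewrite subrr expr0n gtn_eqF// mulr0 !mulr_ge0 ?invr_ge0 ?mulr_ge0// ltW.
  have xm : x m = A / m%:R by rewrite /x; apply/min_idPr/ltW.
  have mx : m%:R * x m = A by rewrite xm mulrC divfK ?gt_eqF.
  have := @expr_onem_le _ (x m) m; rewrite mx => /(_ _) P.
  have {}P : (1 - x m) ^+ m * (1 + A) <= 1 by apply: P; case: xE => /ltW -> ->.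
  have -> : n%:R / (A * A) * A = n%:R / A by field; rewrite gt_eqF.
  rewrite ler_pdivlMr//.
  have mn' : m%:R <= n%:R :> R by rewrite ler_nat.
  have y0 : 0 <= (1 - x m) ^+ m by rewrite exprn_ge0// subr_ge0; case: xE.
  move: ((1 - x m) ^+ m) y0 P => y y0 P; nra.
have W : w / 2 * (m%:R * x m) ^+ 2 <= w * A / 2 * (m%:R * x m).
  rewrite (_ : w * A / 2 * (m%:R * x m) = w / 2 * (A * (m%:R * x m))); last by ring.
  rewrite ler_wpM2l ?divr_ge0// expr2 ler_wpM2r// mulr_ge0 ?(ltW mR)//.
  by case: xE => /ltW.
have m1 : 0 <= w / 2 * (m%:R * x m ^+ 2).
  by rewrite mulr_ge0 ?divr_ge0// mulr_ge0 ?sqr_ge0// ltW.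
have m2 : 0 <= m%:R * (m%:R - 1) * x m ^+ 2.
  by rewrite mulr_ge0 ?sqr_ge0// -natr_ffact2.
have cE : c * (m%:R * x m) = n%:R / (A * A) * (m%:R * x m) + w * A / 2 * (m%:R * x m).
  by rewrite /c mulrDl.
clearbody c; clear - idle W m1 m2 cE.
move: (n%:R / (A * A)) cE idle => b cE idle; rewrite !expr2 in W m1 m2 *.
nra.
Qed.

(** * Sums of square roots, and the upper bound for large [w] *)

Section SqrtSum.
Variable R : realType.
Implicit Types m n j a : nat.

(** The last term is the root of [m - 1]: lower bounds use [sqrt_sum m] as potential, upper bounds
    [sqrt_sum m.+1]. *)
Definition sqrt_sum m : R := \sum_(i < m) Num.sqrt i%:R.

Lemma sqrt_sumS m : sqrt_sum m.+1 = sqrt_sum m + Num.sqrt m%:R.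
Proof. exact: big_ord_recr. Qed.

Lemma sqrt_sum_le1 m : (m <= 1)%N -> sqrt_sum m = 0.
Proof.
case: m => [|[|//]] _; rewrite /sqrt_sum ?big_ord0// big_ord1; exact: sqrtr0.
Qed.

Lemma sqrt_sum_ge0 m : 0 <= sqrt_sum m.
Proof. by apply: sumr_ge0 => i _; exact: sqrtr_ge0. Qed.

Lemma sqrt_sum_mono : {homo sqrt_sum : m n / (m <= n)%N >-> m <= n}.
Proof.
move=> m n /subnK <-; elim: (n - m)%N => // k IH.
by rewrite addSn sqrt_sumS ler_wpDr// sqrtr_ge0.
Qed.

Lemma sqrt_sum_diff_le m j : (j <= m)%N ->
  sqrt_sum m - sqrt_sum (m - j) <= Num.sqrt m.-1%:R * j%:R.
Proof.
move=> /subnK {1 3}<-; elim: j (m - j)%N => [|j IH] a.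
  by rewrite addn0 subrr mulr0.
rewrite addnS sqrt_sumS /= -natr1 mulrDr mulr1 addrAC lerD2r.
apply: le_trans (IH _) _; rewrite ler_wpM2r// ler_wsqrtr// ler_nat leq_pred//.
Qed.

(** Comparison with the integral of the square root; squaring makes the induction step a polynomial
    inequality. *)
Lemma sqrt_sum_le n :
  sqrt_sum n.+1 <= 2 / 3 * n%:R * Num.sqrt n%:R + Num.sqrt n%:R.
Proof.
elim: n => [|n IH]; first by rewrite sqrt_sum_le1// sqrtr0 !mulr0 addr0.
rewrite sqrt_sumS lerD2r; apply: le_trans IH _.
set r := Num.sqrt n%:R; set s := Num.sqrt n.+1%:R.
have r0 : 0 <= r by exact: sqrtr_ge0.
have s0 : 0 <= s by exact: sqrtr_ge0.
have rr : r ^+ 2 = n%:R by rewrite sqr_sqrtr.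
have ss : s ^+ 2 = n%:R + 1 by rewrite sqr_sqrtr// -natr1.
have : r * (2 * n%:R + 3) <= 2 * (n%:R + 1) * s.
  rewrite -ler_sqr ?nnegrE ?mulr_ge0 ?addr_ge0 ?mulr_ge0//.
  rewrite !exprMn rr ss; have : 0 <= n%:R :> R by []; nra.
rewrite -natr1; lra.
Qed.

Lemma sqrt_sum_ge n : 2 / 3 * n%:R * Num.sqrt n%:R <= sqrt_sum n.+1.
Proof.
elim: n => [|n IH]; first by rewrite sqrtr0 mulr0 sqrt_sum_ge0.
rewrite sqrt_sumS -lerBlDr; apply: le_trans IH.
set r := Num.sqrt n%:R; set s := Num.sqrt n.+1%:R.
have r0 : 0 <= r by exact: sqrtr_ge0.
have s0 : 0 <= s by exact: sqrtr_ge0.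
have rr : r ^+ 2 = n%:R by rewrite sqr_sqrtr.
have ss : s ^+ 2 = n%:R + 1 by rewrite sqr_sqrtr// -natr1.
have : (2 * n%:R - 1) * s <= 2 * n%:R * r.
  case: (posnP n) => [->|n0]; first by rewrite !mulr0 !mul0r; lra.
  have n1 : 1 <= n%:R :> R by rewrite ler1n.
  rewrite -ler_sqr ?nnegrE ?mulr_ge0 ?subr_ge0//; last by lra.
  rewrite !exprMn rr ss; nra.
rewrite -natr1; lra.
Qed.

End SqrtSum.

(* The entry probability [2 / (sqrt m * Y) = sqrt (2 / (m * w))] balances the
   expected cost [1 / x] of waiting against the cost [w * m * x / 2] of collisions. *)
Lemma OPT_le_sqrt (R : realType) (n : nat) (Y eps : R) : (0 < n)%N -> 2 <= Y ->
  0 <= eps -> Num.sqrt n%:R * (2 + eps) <= eps * Y ->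
  (OPT n (Y ^+ 2 / 2) <= ((1 + eps) * Y * sqrt_sum R n.+1)%:E)%E.
Proof.
move=> n0 Y2 eps0 nY.
pose x m : R := 2 / (Num.sqrt m%:R * Y).
apply: (@OPT_le _ _ _ (fun m => (1 + eps) * Y * sqrt_sum R m.+1) x) => //
  [|m|m /andP[m0 mn]|m /andP[m0 mn]].
- by rewrite divr_ge0// sqr_ge0.
- by rewrite !mulr_ge0 ?sqrt_sum_ge0//; lra.
- have r1 : 1 <= Num.sqrt m%:R :> R by rewrite -[leLHS]sqrtr1 ler_wsqrtr// ler1n.
  have rY : 2 <= Num.sqrt m%:R * Y by nra.
  by rewrite /x divr_ge0 ?ler_pdivrMr ?mul1r//; lra.
have r1 : 1 <= Num.sqrt m%:R :> R by rewrite -[leLHS]sqrtr1 ler_wsqrtr// ler1n.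
have rn : Num.sqrt m%:R <= Num.sqrt n%:R :> R by rewrite ler_wsqrtr// ler_nat.
have rr : Num.sqrt m%:R ^+ 2 = m%:R :> R by rewrite sqr_sqrtr.
rewrite /x; set r := Num.sqrt m%:R in r1 rn rr *; set xm := 2 / (r * Y).
pose t := r / Y.
have t0 : 0 <= t by rewrite divr_ge0; lra.
(* Equivalent to [1 + t <= (1 + eps) * (1 - t)], which closes the final comparison. *)
have tE : t * (2 + eps) <= eps.
  rewrite /t mulrAC ler_pdivrMr; last by lra.
  by apply: le_trans nY; rewrite ler_wpM2r//; lra.
have mx : m%:R * xm = 2 * t by rewrite /xm /t -rr; field; lra.
have mxx : Y ^+ 2 / 2 / 2 * (m%:R * xm ^+ 2) = 1 by rewrite /xm -rr; field; lra.
have xm0 : 0 <= xm by rewrite divr_ge0 ?mulr_ge0//; lra.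
have xm1 : xm <= 1 by rewrite /xm ler_pdivrMr ?mul1r ?mulr_gt0//; nra.
(* For [j >= 1] only the largest term [r] of the difference is kept; [j - j (j - 1) / 2] is a lower
   bound (Bonferroni) for the indicator of [j >= 1]. *)
apply: (@le_trans _ _ (bin_exp xm m (fun j => (1 + eps) * Y * r *
   (j%:R - 2^-1 * (j%:R * (j%:R - 1)))))); last first.
  apply: le_bin_exp => [_|j jm]; first by rewrite xm0.
  rewrite -mulrBr -mulrA ler_wpM2l ?mulr_ge0//; [lra|lra|].
  case: j jm => [|j] jm; first by rewrite subn0 subrr !mul0r !mulr0 subr0 mulr0.
  apply: (@le_trans _ _ r).
    rewrite ler_piMr//; first by lra.
    have : 0 <= j%:R * (j%:R - 1) :> R by rewrite -natr_ffact2.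
    rewrite -natr1; lra.
  rewrite [sqrt_sum _ m.+1]sqrt_sumS addrAC lerDr subr_ge0.
  by rewrite sqrt_sum_mono// ltn_subrL m0.
rewrite bin_expZ bin_expB bin_expZ bin_exp_id bin_exp_ffact2.
have m1 : 1 <= m%:R :> R by rewrite ler1n.
have p0 : (1 - xm) ^+ m <= 1 by rewrite exprn_ile1//; lra.
have A1 : m%:R * (1 - xm) ^+ m <= m%:R by rewrite ler_piMr.
have A2 : m%:R * (m%:R - 1) * xm * (1 - xm) <= m%:R * (2 * t).
  rewrite -mx; have : 0 <= m%:R * xm by rewrite mulr_ge0.
  nra.
have A3 : Y ^+ 2 / 2 / 2 * (m%:R * (m%:R - 1) * xm ^+ 2) = m%:R - 1.
  transitivity ((m%:R - 1) * (Y ^+ 2 / 2 / 2 * (m%:R * xm ^+ 2))); first by ring.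
  by rewrite mxx mulr1.
have Yr0 : 0 <= (1 + eps) * Y * r by rewrite !mulr_ge0//; lra.
have A4 : (1 + eps) * Y * r * (m%:R * xm - 2^-1 * (m%:R * xm) ^+ 2)
    <= (1 + eps) * Y * r * (m%:R * xm - 2^-1 * (m%:R * (m%:R - 1) * xm ^+ 2)).
  rewrite ler_wpM2l// lerB// ler_wpM2l//; nra.
apply: le_trans A4; rewrite mx A3.
have -> : (1 + eps) * Y * r * (2 * t - 2^-1 * (2 * t) ^+ 2)
    = (1 + eps) * (2 * m%:R * (1 - t)) by rewrite /t -rr; field; lra.
have : 0 <= m%:R * (eps - t * (2 + eps)) by rewrite mulr_ge0// subr_ge0.
lra.
Qed.

(** * The lower bound for large [w] *)

Section LowerBound.
Variables (R : realType) (n : nat) (Y e : R).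
Hypothesis n0 : (0 < n)%N.
Hypothesis e01 : 0 < e <= 1.
Hypothesis Ye : 2 * n%:R ^+ 2 <= Y * e.

Let w := Y ^+ 2 / 2.
Let r m : R := Num.sqrt m.-1%:R.

Let n1 : 1 <= n%:R :> R. Proof. by rewrite ler1n. Qed.

Let Yn : 2 * n%:R ^+ 2 <= Y.
Proof.
have /andP[e0 e1] := e01.
have Y0 : 0 <= Y.
  by rewrite -(pmulr_lge0 _ e0); apply: le_trans Ye; rewrite mulr_ge0 ?sqr_ge0.
by apply: (le_trans Ye); rewrite ler_piMr.
Qed.

Let Y2 : 2 <= Y.
Proof. by apply: le_trans Yn; rewrite ler_peMr// exprn_ege1. Qed.

(* The second and third factorial moments bound the number of collisions from
   below (Bonferroni), and AM-GM optimizes the entry probability [p]. *)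
Let step_empty_few p m : (0 < m <= n)%N -> 0 <= p <= 1 -> m%:R * p <= e ->
  0 <= bin_exp p m (fun j => (m - j)%:R + w * j.-1%:R - (1 - e) * Y * r m * j%:R).
Proof.
move=> /andP[m0 mn] p01 mp; have /andP[p0 p1] := p01.
have /andP[e0 e1] := e01.
apply: (@le_trans _ _ (bin_exp p m (fun j => m%:R - j%:R + w *
   (2^-1 * (j%:R * (j%:R - 1)) - 6^-1 * (j%:R * (j%:R - 1) * (j%:R - 2)))
   - (1 - e) * Y * r m * j%:R))); last first.
  apply: le_bin_exp => // j jm; rewrite natrB// lerD2r lerD2l ler_wpM2l//.
    by rewrite divr_ge0// sqr_ge0.
  case: j jm => [|[|j]] jm /=; [lra|lra|].
  (* With [j + 2] entering agents, the collision count [j + 1] exceeds the Bonferroni bound by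
     [(j + 1) j (j - 1) / 6]. *)
  have : 0 <= (j ^_ 2)%:R * (j%:R + 1) :> R by rewrite mulr_ge0.
  rewrite natr_ffact2 -[j.+2%:R]natr1 -[j.+1%:R]natr1; lra.
rewrite bin_expB bin_expD bin_expB bin_exp_cst !bin_expZ bin_expB !bin_expZ.
rewrite bin_exp_id bin_exp_ffact2 bin_exp_ffact3.
have m1 : 1 <= m%:R :> R by rewrite ler1n.
have r0 : 0 <= r m by exact: sqrtr_ge0.
have rr : r m ^+ 2 = m%:R - 1.
  by rewrite sqr_sqrtr// -{2}(prednK m0) -natr1 addrK.
rewrite /w -rr.
set u := Y * r m * p.
have -> : m%:R - m%:R * p + Y ^+ 2 / 2 * (2^-1 * (m%:R * r m ^+ 2 * p ^+ 2)
    - 6^-1 * (m%:R * r m ^+ 2 * (m%:R - 2) * p ^+ 3)) - (1 - e) * Y * r m * (m%:R * p)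
  = m%:R * ((1 - p) + u ^+ 2 / 4 * (1 - (m%:R - 2) * p / 3) - (1 - e) * u).
  by rewrite /u; field.
apply: mulr_ge0 => //.
have pe : p <= e by nra.
have mpe : (m%:R - 2) * p / 3 <= e by nra.
have s0 : 0 <= 1 - e by lra.
(* As [p] and [(m - 2) p / 3] are at most [e], the bracket is at least this square, which vanishes
   at the balanced value [u = 2]. *)
have : 0 <= (1 - e) * (1 - u / 2) ^+ 2 by rewrite mulr_ge0// sqr_ge0.
have : u ^+ 2 / 4 * (1 - e) <= u ^+ 2 / 4 * (1 - (m%:R - 2) * p / 3).
  by rewrite ler_wpM2l ?divr_ge0 ?sqr_ge0//; lra.
rewrite !expr2; lra.
Qed.

(** Collisions alone suffice here: [j - 1 >= j (j - 1) / m] for [1 <= j <= m], and [Ye] gives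
    [Y * p >= 2 * m]. *)
Let step_empty_many p m : (0 < m <= n)%N -> 0 <= p <= 1 -> e < m%:R * p ->
  0 <= bin_exp p m (fun j => (m - j)%:R + w * j.-1%:R - (1 - e) * Y * r m * j%:R).
Proof.
move=> /andP[m0 mn] p01 mp; have /andP[p0 p1] := p01.
have /andP[e0 e1] := e01.
have w0 : 0 <= w by rewrite divr_ge0// sqr_ge0.
have mR : 0 < m%:R :> R by rewrite ltr0n.
apply: (@le_trans _ _ (bin_exp p m (fun j => w * m%:R^-1 * (j%:R * (j%:R - 1))
   - (1 - e) * Y * r m * j%:R))); last first.
  apply: le_bin_exp => // j jm; rewrite lerD2r ler_wpDl// -mulrA ler_wpM2l//.
  rewrite mulrC ler_pdivrMr//.
  case: j jm => [|j] jm /=; first by rewrite !mul0r.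
  have jm' : j.+1%:R <= m%:R :> R by rewrite ler_nat.
  have j0 : 0 <= j%:R :> R by [].
  by rewrite -[in X in _ * (X - 1)]natr1 addrK mulrC ler_wpM2l.
rewrite bin_expB !bin_expZ bin_exp_id bin_exp_ffact2.
have r0 : 0 <= r m by exact: sqrtr_ge0.
have rr : r m ^+ 2 = m%:R - 1.
  by rewrite sqr_sqrtr// -{2}(prednK m0) -natr1 addrK.
(* [r m] is either 0 or at least 1. *)
have r1 : r m <= r m ^+ 2.
  have [m1|m1] := leqP m 1.
    by rewrite /r (_ : m.-1 = 0)%N ?sqrtr0 ?expr2 ?mulr0//; case: (m) m1 => [|[|]].
  have : 1 <= r m by rewrite -[leLHS]sqrtr1 ler_wsqrtr// ler1n -subn1 subn_gt0.
  rewrite expr2; nra.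
have -> : w * m%:R^-1 * (m%:R * (m%:R - 1) * p ^+ 2) - (1 - e) * Y * r m * (m%:R * p)
  = Y * p * (Y * p / 2 * r m ^+ 2 - (1 - e) * r m * m%:R).
  by rewrite rr /w; field; rewrite gt_eqF.
have Y0 := Y2.
rewrite mulr_ge0 ?mulr_ge0//; first by lra.
have mn' : m%:R <= n%:R :> R by rewrite ler_nat.
have Yp : 2 * m%:R <= Y * p.
  rewrite -(ler_pM2r mR); apply: (@le_trans _ _ (Y * e)).
    by apply: le_trans Ye; rewrite expr2; nra.
  by rewrite -mulrA ler_wpM2l//; [lra|rewrite mulrC ltW].
have : m%:R * r m ^+ 2 <= Y * p / 2 * r m ^+ 2.
  by rewrite ler_wpM2r ?sqr_ge0//; lra.
have : m%:R * r m <= m%:R * r m ^+ 2 by rewrite ler_wpM2l.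
have : 0 <= e * (m%:R * r m) by rewrite !mulr_ge0// ltW.
lra.
Qed.

(** Each entering agent lowers the potential by at most [(1 - e) * Y * r m]. At an empty queue the
    two cases above pay for this; at a nonempty one, each entering agent already adds a waiting cost
    [w], which is at least as large. *)
Lemma OPT_ge_sqrt : (((1 - e) * Y * sqrt_sum R n)%:E <= OPT n (Y ^+ 2 / 2))%E.
Proof.
have /andP[e0 e1] := e01; have YY := Y2; have D0 : 0 <= (1 - e) * Y by nra.
apply: (@OPT_ge _ _ _ (fun m k => (1 - e) * Y * sqrt_sum R m)
  ((1 - e) * Y * sqrt_sum R n + 1)) => //.
- by rewrite ler_pdivlMr// expr2; nra.
- by rewrite ltr_wpDl// mulr_ge0// sqrt_sum_ge0.
- move=> m k mkn; rewrite ler_wpDr// ler_wpM2l// sqrt_sum_mono//; lia.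
- move=> m k mk; rewrite sqrt_sum_le1 ?mulr0//; lia.
move=> p m k mkn p01; rewrite -subr_ge0 -[X in _ - X](bin_exp_cst p m) -bin_expB.
apply: (@le_trans _ _ (bin_exp p m
   (fun j => (m - j)%:R + w * (k + j).-1%:R - (1 - e) * Y * r m * j%:R))); last first.
  apply: le_bin_exp => // j jm.
  have := ler_wpM2l D0 (sqrt_sum_diff_le R jm); rewrite /w /r; lra.
have w0 : 0 <= w by rewrite divr_ge0// sqr_ge0.
have [->|m0] := posnP m.
  rewrite bin_exp_size0 [X in _ - X]mulr0 subr0.
  by apply: addr_ge0; last exact: mulr_ge0.
have mn : (m <= n)%N by rewrite (leq_trans _ mkn) ?leq_addr.
have {}p01 := p01 m0.
case: k mkn => [|k] mkn.
  have [mp|mp] := leP (m%:R * p) e; first by apply: step_empty_few; rewrite ?m0.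
  by apply: step_empty_many; rewrite ?m0.
rewrite -[leLHS](bin_exp_cst p m); apply: le_bin_exp => // j jm.
have rm : r m <= n%:R.
  have -> : n%:R = Num.sqrt (n%:R ^+ 2) :> R by rewrite sqrtr_sqr normr_nat.
  rewrite ler_wsqrtr// -natrX ler_nat.
  by rewrite (leq_trans (leq_pred m))// (leq_trans mn)// -{1}[n]expn1 leq_pexp2l.
have r0 : 0 <= r m by exact: sqrtr_ge0.
have Dw : (1 - e) * Y * r m <= w.
  have nn := n1; have Ynn := Yn; have : 2 * r m <= Y by nra.
  by rewrite /w expr2; nra.
rewrite subr_ge0 ler_wpDl//.
apply: (@le_trans _ _ (w * j%:R)); first by rewrite ler_wpM2r.
by rewrite ler_wpM2l// ler_nat leq_addl.
Qed.

End LowerBound.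

(** * Choice of the thresholds in [n] and [w] *)

Theorem theorem5p1 (R : realType) :
  (forall w eps : R, 2 < w -> 0 < eps ->
     exists n0 : nat, forall n : nat, (2 <= n)%N -> (n0 < n)%N ->
       ((n%:R * (n%:R - 1) / 2)%:E <= OPT n w)%E /\
       (OPT n w <= ((1 + eps) * (n%:R * (n%:R - 1) / 2))%:E)%E)
  /\
  (forall (n : nat) (eps : R), (2 <= n)%N -> 0 < eps ->
     exists w1 : R, forall w : R, 1 < w -> w1 < w ->
       (((1 - eps) * Num.sqrt (2 * w) *
           (2 / 3 * (n%:R - 1) * Num.sqrt (n%:R - 1)))%:E <= OPT n w)%E /\
       (OPT n w <= ((1 + eps) * Num.sqrt (2 * w) *
           (2 / 3 * n%:R * Num.sqrt n%:R + Num.sqrt n%:R))%:E)%E).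
Proof.
split=> [w eps w2 eps0|n eps n2 eps0].
  (* [A * A >= 4 / eps] keeps idling below half of the allowed excess [n * eps / 2] per agent, up to
     lower order; large [n] absorbs the collision term [w * A / 2]. *)
  pose A := 1 + 4 / eps.
  have A0 : 0 < 4 / eps by rewrite divr_gt0.
  exists (Num.truncn ((2 * w * A + 2 * eps) / eps)).+1 => n n2 n0n.
  have nA : 2 * w * A + 2 * eps < n%:R * eps.
    rewrite -ltr_pdivrMr//; apply: lt_trans (truncnS_gt _) _.
    by rewrite ltr_nat.
  have n0 : (0 < n)%N by lia.
  split; first by apply: OPT_ge_triangular; [|lra].
  have A1 : 1 <= A by rewrite /A; lra.
  have w0 : 0 <= w by lra.
  apply: le_trans (OPT_le_refill n0 w0 A1) _.
  have AA : n%:R / (A * A) <= n%:R * (eps / 4).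
    rewrite ler_wpM2l// -[eps / 4]invf_div lef_pV2 ?posrE ?mulr_gt0//; try lra.
    by rewrite /A; nra.
  rewrite lee_fin.
  have n1 : 1 <= n%:R :> R by rewrite ler1n.
  have : 0 <= n%:R * (eps * (n%:R - 1) / 2 - (n%:R / (A * A) + w * A / 2)).
    by rewrite mulr_ge0//; lra.
  lra.
have n0 : (0 < n)%N by lia.
(* [OPT_ge_sqrt] asks for [e <= 1], and a smaller [e] gives a stronger lower bound. *)
pose e := Num.min eps 1.
have e01 : 0 < e <= 1 by rewrite /e lt_min eps0 ltr01 ge_min lexx orbT.
have /andP[e0 e1] := e01.
(* The three summands secure [2 <= Y], [Ye] and [nY] in turn. *)
pose B := 2 + 2 * n%:R ^+ 2 / e + Num.sqrt n%:R * (2 + eps) / eps.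
exists (B ^+ 2) => w w1 wB.
set Y := Num.sqrt (2 * w).
have B1 : 0 <= 2 * n%:R ^+ 2 / e by rewrite divr_ge0 ?mulr_ge0 ?sqr_ge0//; lra.
have B2 : 0 <= Num.sqrt n%:R * (2 + eps) / eps.
  by rewrite divr_ge0 ?mulr_ge0 ?sqrtr_ge0//; lra.
have BY : B <= Y.
  have -> : B = Num.sqrt (B ^+ 2) by rewrite sqrtr_sqr ger0_norm// /B; lra.
  by rewrite ler_wsqrtr//; lra.
have wY : w = Y ^+ 2 / 2 by rewrite /Y sqr_sqrtr; lra.
have Y0 : 0 <= Y by exact: sqrtr_ge0.
have nE : n%:R - 1 = n.-1%:R :> R by rewrite -{1}(prednK n0) -natr1 addrK.
rewrite wY; split.
  have Ye : 2 * n%:R ^+ 2 <= Y * e.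
    by rewrite -ler_pdivrMr//; apply: le_trans BY; rewrite /B; lra.
  apply: le_trans (OPT_ge_sqrt n0 e01 Ye); rewrite lee_fin nE.
  apply: (@le_trans _ _ ((1 - e) * Y * (2 / 3 * n.-1%:R * Num.sqrt n.-1%:R))).
    rewrite ler_wpM2r ?mulr_ge0 ?sqrtr_ge0// ler_wpM2r// lerB//.
    by rewrite /e ge_min lexx.
  rewrite ler_wpM2l ?mulr_ge0 ?subr_ge0// -{3}(prednK n0); exact: sqrt_sum_ge.
have Y2 : 2 <= Y by apply: le_trans BY; rewrite /B; lra.
have nY : Num.sqrt n%:R * (2 + eps) <= eps * Y.
  by rewrite [leRHS]mulrC -ler_pdivrMr//; apply: le_trans BY; rewrite /B; lra.
apply: le_trans (OPT_le_sqrt n0 Y2 (ltW eps0) nY) _; rewrite lee_fin.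
by rewrite ler_wpM2l ?mulr_ge0 ?sqrt_sum_le//; lra.
Qed.
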